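(* There exists a computable measure $P$ on $\mathbb N\times 2^{\mathbb N}$ such that: (1) for each $S\subseteq\mathbb N$, the function $\beta\mapsto P_C(S\mid\beta)$ is defined and continuous on all of $2^{\mathbb N}$; and (2) the set of $\beta\in 2^{\mathbb N}$ for which $P_C(\cdot\mid\beta)$ is not computable relative to $\beta$ has $P_M$-measure one.
   Context: $2^{\mathbb N}$ denotes Cantor space; for a finite binary string $x$, $[x]$ is the set of infinite sequences extending $x$. A measure $P$ on $\mathbb N\times 2^{\mathbb N}$ is computable if the map $(n,x)\mapsto P(\{n\}\times[x])$ is computable as a real-valued function. The marginal measure is $P_M(T)=P(\mathbb N\times T)$ for measurable $T\subseteq 2^{\mathbb N}$. For $\beta\in 2^{\mathbb N}$ and $S\subseteq\mathbb N$, the conditional measure is $P_C(S\mid\beta)=\lim_{k\to\infty}\frac{P(S\times[\beta_1\dots\beta_k])}{P(\mathbb N\times[\beta_1\dots\beta_k])}$ (when the limit exists). $P_C(\cdot\mid\beta)$ is computable relative to $\beta$ if the map $n\mapsto P_C(\{n\}\mid\beta)$ is computable as a real-valued function by a machine with oracle $\beta$. *)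

(* Defs.v *)
(* MathComp-Analysis; from Stdlib only the Cantor pairing of natural numbers. *)
From mathcomp Require Import all_boot all_order all_algebra.
From mathcomp Require Import all_classical all_reals all_analysis.
From Stdlib Require Cantor.

Set Implicit Arguments.
Unset Strict Implicit.
Unset Printing Implicit Defensive.

Import Order.TTheory GRing.Theory Num.Theory.
Import numFieldNormedType.Exports.

Local Open Scope classical_set_scope.
Local Open Scope ring_scope.

(* Computability is Kleene's: partial recursive functions, relative to an
   oracle in Cantor space. Several arguments are passed as one number through
   the pairing bijection Cantor.to_nat, with inverse Cantor.of_nat. *)

Inductive code : Type :=
| Zero
| Succ
| Fst
| Snd
| Oracle
| Pair of code & code
| Comp of code & code
| PrimRec of code & code
| Mu of code.

Fixpoint primrec_rel (F G : nat -> nat -> Prop) (a n y : nat) : Prop :=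
  if n is n'.+1 then
    exists2 u, primrec_rel F G a n' u
             & G (Cantor.to_nat (a, Cantor.to_nat (n', u))) y
  else F a y.

(* [code_eval b c a y]: on input [a] and with oracle [b], the program [c] halts
   with output [y]. [PrimRec f g] on input <a, n> is primitive recursion on n
   with parameter a; [Mu f] on input a returns the least y such that
   f <a, y> = 0 and is undefined if f <a, i> diverges for some smaller i. *)
Fixpoint code_eval (b : nat -> bool) (c : code) (a y : nat) : Prop :=
  match c with
  | Zero => y = 0%N
  | Succ => y = a.+1
  | Fst => y = (Cantor.of_nat a).1
  | Snd => y = (Cantor.of_nat a).2
  | Oracle => y = b a
  | Pair f g => exists u v,
      [/\ code_eval b f a u, code_eval b g a v & y = Cantor.to_nat (u, v)]
  | Comp f g => exists2 u, code_eval b g a u & code_eval b f u y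
  | PrimRec f g =>
      primrec_rel (code_eval b f) (code_eval b g)
        (Cantor.of_nat a).1 (Cantor.of_nat a).2 y
  | Mu f => code_eval b f (Cantor.to_nat (a, y)) 0%N /\
      (forall i, (i < y)%N ->
         exists z, code_eval b f (Cantor.to_nat (a, i)) z.+1)
  end.

Fixpoint oracle_free (c : code) : bool :=
  match c with
  | Oracle => false
  | Pair f g | Comp f g | PrimRec f g => oracle_free f && oracle_free g
  | Mu f => oracle_free f
  | _ => true
  end.

(* <p, <q, d>> denotes the rational (p - q) / (d + 1); every rational has such
   a name. *)
Definition rat_of_code (m : nat) : rat :=
  let: (p, m') := Cantor.of_nat m in
  let: (q, d) := Cantor.of_nat m' in
  (p%:R - q%:R) / d.+1%:R.

(* Bijective base-2 numeration, least significant digit first. *)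
Definition string_code (x : seq bool) : nat :=
  foldr (fun (a : bool) m => m.*2 + a.+1)%N 0%N x.

Section ComputableRealFunctions.
Context {R : realType}.

(* With oracle [b], given (the code of) [x] and [k], [c] outputs a rational
   within 2^-k of [f x]. *)
Definition approximates (b : nat -> bool) (c : code) (X : Type)
    (enc : X -> nat) (f : X -> R) : Prop :=
  forall (x : X) (k : nat),
    exists2 m, code_eval b c (Cantor.to_nat (enc x, k)) m
             & `| ratr (rat_of_code m) - f x | <= 2 ^- k.

(* The quantification over [b] is vacuous: [c] never queries the oracle. *)
Definition computable (X : Type) (enc : X -> nat) (f : X -> R) : Prop :=
  exists2 c, oracle_free c & forall b, approximates b c enc f.

Definition computable_rel (b : nat -> bool) (X : Type) (enc : X -> nat)
    (f : X -> R) : Prop :=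
  exists c, approximates b c enc f.

End ComputableRealFunctions.

(* Cantor space with its Borel sigma-algebra. *)
Definition cantor : Type := g_sigma_algebraType (@open cantor_space).

Definition cylinder (x : seq bool) : set cantor :=
  [set b | mkseq b (size x) = x].

Section ConditionalMeasure.
Context {R : realType}.
Variable P : probability (nat * cantor)%type R.

Definition computable_measure : Prop :=
  computable (fun nx : nat * seq bool =>
                Cantor.to_nat (nx.1, string_code nx.2))
             (fun nx => fine (P ([set nx.1] `*` cylinder nx.2))).

Definition marginal (T : set cantor) : \bar R := P ([set: nat] `*` T).

Definition cond_ratio (S : set nat) (b : cantor) (k : nat) : R :=
  fine (P (S `*` cylinder (mkseq b k))) /
  fine (P ([set: nat] `*` cylinder (mkseq b k))).

(* The nonvanishing of the denominators must be required explicitly, since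
   x / 0 = 0 in the library. *)
Definition cond_defined (S : set nat) (b : cantor) : Prop :=
  (forall k, P ([set: nat] `*` cylinder (mkseq b k)) != 0%E) /\
  cvgn (cond_ratio S b).

Definition cond (S : set nat) (b : cantor) : R := limn (cond_ratio S b).

Definition cond_computable_rel (b : cantor) : Prop :=
  computable_rel b (fun n : nat => n) (fun n => cond [set n] b).

End ConditionalMeasure.

(* Main.v *)
(* Let lambda be the fair-coin measure. Under P the second coordinate beta has
   law lambda; the first one is drawn together with beta as follows. Draw m in N,
   independently of beta, with P(m = 2n) = P(m = 2n+1) = 2^-(n+2). If the n-th
   "computation" never halts, output m; if it halts at time s, output
   2n + beta_s. On a cylinder of length at most s the bit beta_s is still fair,
   so the values of P on cylinders do not reveal whether n halts after time s,
   and they are computable. But P_C({2n} | beta) is 2^-(n+2) if n does not halt,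
   and 0 or 2^-(n+1) if it does; it depends on a single bit of beta, whence
   continuity, and a program computing P_C(. | beta) from beta decides halting.

   The computation number <<e, J>, s> halts at the first time t at which more
   than a fraction 1/J of the oracles make program e output s on input <e, J>
   within t steps. Suppose some program decides halting for all beta in A, and let
   e search for the least s such that <<e, J>, s> does not halt. Such an s exists,
   for otherwise the J disjoint events "e outputs s", s < J, would each have
   measure > 1/J. All beta in A make e output this s, and as the computation
   does not halt, A has measure at most 1/J. This holds for every J, so A is
   null. *)
Require Import Defs.
From mathcomp Require Import all_boot all_order all_algebra.
From mathcomp Require Import all_classical all_reals all_analysis.
From mathcomp Require Import zify ring lra.
From Stdlib Require Cantor.
Import Order.TTheory GRing.Theory Num.Theory.
Import numFieldNormedType.Exports.

Set Implicit Arguments.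
Unset Strict Implicit.
Unset Printing Implicit Defensive.

(** * Total recursive functions *)

Local Open Scope nat_scope.

Local Notation "<< a , b >>" := (Cantor.to_nat (a, b)) : nat_scope.
Local Notation pfst a := (Cantor.of_nat a).1.
Local Notation psnd a := (Cantor.of_nat a).2.
Arguments Cantor.to_nat : simpl never.
Arguments Cantor.of_nat : simpl never.

Lemma pairK p : Cantor.of_nat (Cantor.to_nat p) = p.
Proof. exact: Cantor.cancel_of_to. Qed.

(** One program has to serve for all oracles. Several arguments are packed by pairing, and a
    predicate is coerced to its 0/1 values. *)
Definition crec (f : nat -> nat) : Prop :=
  exists2 c, oracle_free c & forall b a, code_eval b c a (f a).

Lemma crec_id : crec (fun a => a).
Proof.
(* No basic program is the identity; taking a number apart and pairing its components again gives
   it, as the pairing is onto. *)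
exists (Pair Fst Snd) => // b a /=; exists (pfst a), (psnd a); split=> //.
by rewrite -surjective_pairing Cantor.cancel_to_of.
Qed.

Lemma crec_comp f g : crec f -> crec g -> crec (fun a => f (g a)).
Proof.
move=> [cf of_ Hf] [cg og Hg]; exists (Comp cf cg); first by rewrite /= of_.
by move=> b a /=; exists (g a).
Qed.

Lemma crec_succ f : crec f -> crec (fun a => (f a).+1).
Proof. by apply: (@crec_comp succn); exists Succ. Qed.

Lemma crec_fst f : crec f -> crec (fun a => pfst (f a)).
Proof. by apply: (@crec_comp (fun a => pfst a)); exists Fst. Qed.

Lemma crec_snd f : crec f -> crec (fun a => psnd (f a)).
Proof. by apply: (@crec_comp (fun a => psnd a)); exists Snd. Qed.

Lemma crec_const k : crec (fun=> k).
Proof.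
elim: k => [|k IH]; first by exists Zero.
exact: crec_succ.
Qed.

Lemma crec_pair f g : crec f -> crec g -> crec (fun a => <<f a, g a>>).
Proof.
move=> [cf of_ Hf] [cg og Hg]; exists (Pair cf cg); first by rewrite /= of_.
by move=> b a /=; exists (f a), (g a).
Qed.

(** The step function may depend on the input [a], which is handed to [PrimRec] as its parameter;
    the arguments of [f] are nested as [PrimRec] nests them. *)
Lemma crec_rec x n (f : nat -> nat -> nat -> nat) : crec x -> crec n ->
  crec (fun p => f (pfst p) (pfst (psnd p)) (psnd (psnd p))) ->
  crec (fun a => nat_rect (fun=> nat) (x a) (f a) (n a)).
Proof.
move=> [cx ox Hx] [cn on Hn] [cf of_ Hf]; have [ci oi Hi] := crec_id.
exists (Comp (PrimRec cx cf) (Pair ci cn)); first by rewrite /= ox of_ oi.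
move=> b a /=; exists <<a, n a>>; first by exists a, (n a).
rewrite pairK /=; elim: (n a) => [|k IH] /=; first exact: Hx.
eexists; first exact: IH.
by have := Hf b <<a, <<k, nat_rect (fun=> nat) (x a) (f a) k>> >>; rewrite !pairK.
Qed.

Lemma crec_iter x n (f : nat -> nat -> nat) : crec x -> crec n ->
  crec (fun p => f (pfst p) (psnd p)) ->
  crec (fun a => iter (n a) (f a) (x a)).
Proof.
move=> Hx Hn Hf.
have : crec (fun a => nat_rect (fun=> nat) (x a) (fun=> f a) (n a)).
  apply: crec_rec => //.
  have := crec_comp Hf (crec_pair (crec_fst crec_id) (crec_snd (crec_snd crec_id))).
  by congr crec; apply/funext => p; rewrite !pairK.
by congr crec; apply/funext => a; elim: (n a) => //= k ->.
Qed.

Lemma crec_add f g : crec f -> crec g -> crec (fun a => f a + g a).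
Proof.
move=> Hf Hg; have : crec (fun a => iter (g a) succn (f a)).
  apply: (crec_iter (f := fun=> succn)) => //.
  exact/crec_succ/crec_snd/crec_id.
by congr crec; apply/funext => a; rewrite iter_succn addnC.
Qed.

Lemma crec_pred f : crec f -> crec (fun a => (f a).-1).
Proof.
apply: (@crec_comp predn).
have : crec (fun a => nat_rect (fun=> nat) 0 (fun i _ => i) a).
  apply: (crec_rec (f := fun _ i _ => i));
  [exact: crec_const|exact: crec_id|exact/crec_fst/crec_snd/crec_id].
by congr crec; apply/funext => -[].
Qed.

Lemma crec_sub f g : crec f -> crec g -> crec (fun a => f a - g a).
Proof.
move=> Hf Hg; have : crec (fun a => iter (g a) predn (f a)).
  apply: (crec_iter (f := fun=> predn)) => //.
  exact/crec_pred/crec_snd/crec_id.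
by congr crec; apply/funext => a; elim: (g a) => /= [|k ->]; rewrite ?subn0 ?subnS.
Qed.

Lemma crec_mul f g : crec f -> crec g -> crec (fun a => f a * g a).
Proof.
move=> Hf Hg; have : crec (fun a => iter (g a) (addn (f a)) 0).
  apply: (crec_iter (f := fun a => addn (f a))) => //; first exact: crec_const.
  apply: crec_add; last exact/crec_snd/crec_id.
  exact: (crec_comp Hf (crec_fst crec_id)).
by congr crec; apply/funext => a; rewrite iter_addn_0.
Qed.

Lemma crec_leq f g : crec f -> crec g -> crec (fun a => f a <= g a).
Proof.
move=> Hf Hg; have := crec_sub (crec_const 1) (crec_sub Hf Hg).
by congr crec; apply/funext => a; rewrite -subn_eq0; case: (f a - g a).
Qed.

Lemma crec_and (f g : nat -> bool) : crec f -> crec g ->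
  crec (fun a => f a && g a).
Proof.
move=> Hf Hg; have := crec_mul Hf Hg.
by congr crec; apply/funext => a; rewrite mulnb.
Qed.

Lemma crec_not (f : nat -> bool) : crec f -> crec (fun a => ~~ f a).
Proof.
move=> Hf; have := crec_sub (crec_const 1) Hf.
by congr crec; apply/funext => a; case: (f a).
Qed.

Lemma crec_eq (f g : nat -> nat) : crec f -> crec g -> crec (fun a => f a == g a).
Proof.
move=> Hf Hg; have := crec_and (crec_leq Hf Hg) (crec_leq Hg Hf).
by congr crec; apply/funext => a; rewrite eqn_leq.
Qed.

Lemma crec_if (b : nat -> bool) f g : crec b -> crec f -> crec g ->
  crec (fun a => if b a then f a else g a).
Proof.
move=> Hb Hf Hg.
have := crec_add (crec_mul Hb Hf) (crec_mul (crec_not Hb) Hg).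
by congr crec; apply/funext => a; case: (b a); rewrite mul0n mul1n ?addn0.
Qed.

Lemma crec_sum n (f : nat -> nat -> nat) : crec n ->
  crec (fun p => f (pfst p) (psnd p)) ->
  crec (fun a => \sum_(i < n a) f a i).
Proof.
move=> Hn Hf.
have : crec (fun a => nat_rect (fun=> nat) 0 (fun i u => u + f a i) (n a)).
  apply: (crec_rec (f := fun a i u => u + f a i)) => //; first exact: crec_const.
  apply: crec_add; first exact/crec_snd/crec_snd/crec_id.
  have := crec_comp Hf (crec_pair (crec_fst crec_id) (crec_fst (crec_snd crec_id))).
  by congr crec; apply/funext => p; rewrite !pairK.
congr crec; apply/funext => a; elim: (n a) => [|k IH]; first by rewrite big_ord0.
by rewrite big_ord_recr /= IH.
Qed.

Lemma crec_odd f : crec f -> crec (fun a => odd (f a)).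
Proof.
move=> Hf; have : crec (fun a => iter (f a) (fun u => 1 - u) 0).
  apply: (crec_iter (f := fun=> fun u => 1 - u)) => //; first exact: crec_const.
  exact: crec_sub (crec_const 1) (crec_snd crec_id).
by congr crec; apply/funext => a; elim: (f a) => //= k ->; case: odd.
Qed.

(** Turns halving into a bounded sum, to which [crec_sum] applies. *)
Lemma half_sum_odd n : n./2 = \sum_(i < n) odd i.
Proof. by elim: n => [|n IH]; rewrite ?big_ord0// big_ord_recr /= -IH; lia. Qed.

Lemma crec_half f : crec f -> crec (fun a => (f a)./2).
Proof.
move=> Hf; have : crec (fun a => \sum_(i < f a) odd i).
  by apply: (crec_sum (f := fun _ i => odd i)) => //; exact/crec_odd/crec_snd/crec_id.
by congr crec; apply/funext => a; rewrite half_sum_odd.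
Qed.

Lemma crec_exp2 f : crec f -> crec (fun a => 2 ^ f a).
Proof.
move=> Hf; have : crec (fun a => iter (f a) (muln 2) 1).
  apply: (crec_iter (f := fun=> muln 2)) => //; first exact: crec_const.
  exact: crec_mul (crec_const 2) (crec_snd crec_id).
by congr crec; apply/funext => a; elim: (f a) => //= k ->; rewrite expnS.
Qed.

(* [nat_of_bool] is itself an [if], on which [crec_if] would loop: hence the
   [fail] cases. *)
Ltac crec := cbv beta; repeat lazymatch goal with
  | |- crec (fun a => a) => exact: crec_id
  | |- crec (fun _ => ?k) => exact: crec_const
  | |- crec (fun a => (Cantor.of_nat (@?f a)).1) => refine (@crec_fst f _)
  | |- crec (fun a => (Cantor.of_nat (@?f a)).2) => refine (@crec_snd f _)
  | |- crec (fun a => Cantor.to_nat (@?f a, @?g a)) => refine (@crec_pair f g _ _)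
  | |- crec (fun a => nat_of_bool (odd (@?f a))) => refine (@crec_odd f _)
  | |- crec (fun a => nat_of_bool (@?f a == @?g a)) => refine (@crec_eq f g _ _)
  | |- crec (fun a => nat_of_bool (@?f a <= @?g a)) => refine (@crec_leq f g _ _)
  | |- crec (fun a => nat_of_bool (@?f a && @?g a)) => refine (@crec_and f g _ _)
  | |- crec (fun a => nat_of_bool (~~ @?f a)) => refine (@crec_not f _)
  | |- crec (fun a => (@?f a)./2) => refine (@crec_half f _)
  | |- crec (fun a => 2 ^ @?f a) => refine (@crec_exp2 f _)
  | |- crec (fun a => (@?f a).-1) => refine (@crec_pred f _)
  | |- crec (fun a => (@?f a).+1) => refine (@crec_succ f _)
  | |- crec (fun a => @?f a + @?g a) => refine (@crec_add f g _ _)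
  | |- crec (fun a => @?f a - @?g a) => refine (@crec_sub f g _ _)
  | |- crec (fun a => @?f a * @?g a) => refine (@crec_mul f g _ _)
  | H : crec ?f |- crec ?f => exact: H
  | H : crec ?f |- crec (fun a => ?f a) => exact: H
  | |- crec (fun a => nat_of_bool (@?b a)) => fail
  | |- crec (fun a => @bigop.body _ _ _ (@?r a) (@?F a)) => fail
  | |- crec (fun a => iter (@?n a) (@?f a) (@?x a)) => fail
  | _ => apply: crec_if
  end.

(** * A stack machine *)

(* Stack frames 0-8 are programs to be run on the current value; frames 9-12,
   pushed by [exec], resume a [Pair] (9, 11), [PrimRec] (10) or [Mu] (12). *)
Fixpoint code_num (c : Defs.code) : nat :=
  match c with
  | Zero => <<0, 0>>
  | Succ => <<1, 0>>
  | Fst => <<2, 0>>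
  | Snd => <<3, 0>>
  | Oracle => <<4, 0>>
  | Pair f g => <<5, <<code_num f, code_num g>> >>
  | Comp f g => <<6, <<code_num f, code_num g>> >>
  | PrimRec f g => <<7, <<code_num f, code_num g>> >>
  | Mu f => <<8, code_num f>>
  end.

(** The successor keeps 0 free to code the empty stack. *)
Definition push F K := <<F, K>>.+1.

(** A state [st] is the current value paired with the stack: [v] is the value, [F] the top frame
    with payload [p], and [K] the rest of the stack. A query answered by more than 1 leaves the
    state unchanged. *)
Definition exec (q : nat -> nat) (st v F p K : nat) : nat :=
  let tag := pfst F in
  if tag == 0 then <<0, K>> else
  if tag == 1 then <<v.+1, K>> else
  if tag == 2 then <<pfst v, K>> else
  if tag == 3 then <<psnd v, K>> else
  if tag == 4 then (if q v <= 1 then <<q v, K>> else st) else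
  if tag == 5 then <<v, push (pfst p) (push <<9, <<psnd p, v>> >> K)>> else
  if tag == 6 then <<v, push (psnd p) (push (pfst p) K)>> else
  if tag == 7 then
    (if psnd v == 0 then <<pfst v, push (pfst p) K>> else
     << <<pfst v, (psnd v).-1>>,
       push F (push <<10, <<psnd p, <<pfst v, (psnd v).-1>> >> >> K)>>) else
  if tag == 8 then << <<v, 0>>, push p (push <<12, <<p, <<v, 0>> >> >> K)>> else
  if tag == 9 then <<psnd p, push (pfst p) (push <<11, v>> K)>> else
  if tag == 10 then
    << <<pfst (psnd p), <<psnd (psnd p), v>> >>, push (pfst p) K>> else
  if tag == 11 then << <<p, v>>, K>> else
  if v == 0 then <<psnd (psnd p), K>> else
  << <<pfst (psnd p), (psnd (psnd p)).+1>>,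
     push (pfst p)
       (push <<12, <<pfst p, <<pfst (psnd p), (psnd (psnd p)).+1>> >> >> K)>>.

Definition step (q : nat -> nat) (st : nat) : nat :=
  let K := psnd st in let F := pfst K.-1 in
  if K == 0 then st else exec q st (pfst st) F (psnd F) (psnd K.-1).

Lemma step_push q v F K :
  step q <<v, push F K>> = exec q <<v, push F K>> v F (psnd F) K.
Proof. by rewrite /step pairK /= pairK. Qed.

Lemma step_halt q v : step q <<v, 0>> = <<v, 0>>.
Proof. by rewrite /step pairK. Qed.

Lemma iter_halt q n v : iter n (step q) <<v, 0>> = <<v, 0>>.
Proof. by elim: n => //= n ->; rewrite step_halt. Qed.

Definition reach q st st' := exists n, iter n (step q) st = st'.

Lemma reach_refl q st : reach q st st.
Proof. by exists 0. Qed.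

Lemma reach_step q st st' : reach q (step q st) st' -> reach q st st'.
Proof. by case=> n <-; exists n.+1; rewrite iterSr. Qed.

Lemma reach_trans q st1 st2 st3 :
  reach q st1 st2 -> reach q st2 st3 -> reach q st1 st3.
Proof. by move=> [m <-] [n <-]; exists (n + m); rewrite iterD. Qed.

Ltac mstep := apply: reach_step; rewrite step_push /exec ?pairK /= ?pairK /= ?pairK.

(* The converse is never needed: disjointness of the output events only uses that
   the machine is deterministic. *)
Lemma machine_complete (b : nat -> bool) c a y K : code_eval b c a y ->
  reach (fun i => b i) <<a, push (code_num c) K>> <<y, K>>.
Proof.
elim: c a y K => [||||| f IHf g IHg | f IHf g IHg | f IHf g IHg | f IHf] a y K /=.
- by move=> ->; mstep; exact: reach_refl.
- by move=> ->; mstep; exact: reach_refl.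
- by move=> ->; mstep; exact: reach_refl.
- by move=> ->; mstep; exact: reach_refl.
- by move=> ->; mstep; rewrite leq_b1; exact: reach_refl.
- move=> [u [v [Hf Hg ->]]]; mstep.
  apply: reach_trans (IHf _ _ _ Hf) _.
  mstep.
  apply: reach_trans (IHg _ _ _ Hg) _.
  by mstep; exact: reach_refl.
- move=> [u Hg Hf]; mstep.
  by apply: reach_trans (IHg _ _ _ Hg) _; exact: IHf.
- set F := <<7, _>>.
  have [{}a [n ->]] : exists a' n, a = <<a', n>>.
    by exists (pfst a), (psnd a); rewrite -surjective_pairing Cantor.cancel_to_of.
  rewrite pairK /=; elim: n y K => [|n IHn] y K /=.
    move=> Hf; mstep.
    exact: IHf.
  move=> [u Hu Hg]; mstep.
  apply: reach_trans (IHn _ _ Hu) _.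
  mstep.
  exact: IHg.
- move=> [Hy Hlt]; mstep.
  (* Loop invariant of the search: after [i] nonzero answers the machine is about to run [f] on <a,
     i>, with frame 12 remembering [i]. *)
  have : forall i, i <= y -> reach (fun i => b i)
    << <<a, 0>>, push (code_num f) (push <<12, <<code_num f, <<a, 0>> >> >> K)>>
    << <<a, i>>, push (code_num f) (push <<12, <<code_num f, <<a, i>> >> >> K)>>.
    elim=> [|i IHi] iy; first exact: reach_refl.
    have [z Hz] := Hlt _ iy; apply: reach_trans (IHi (ltnW iy)) _.
    apply: reach_trans (IHf _ _ _ Hz) _; mstep; exact: reach_refl.
  move=> /(_ y (leqnn y)) H; apply: reach_trans H _.
  apply: reach_trans (IHf _ _ _ Hy) _; mstep; exact: reach_refl.
Qed.

(** * Finite parts of the oracle and time-bounded runs *)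

Definition extends (q q' : nat -> nat) := forall i, q i <= 1 -> q' i = q i.

(** Only a query, tag 4, consults the oracle. If its answer is at most 1, then [q'] agrees;
    otherwise the machine is stuck under [q]. *)
Lemma step_extends q q' st : extends q q' ->
  step q st = st \/ step q' st = step q st.
Proof.
move=> qq'; rewrite /step; case: eqP => _; first by left.
rewrite /exec; have /orP[/[dup] qv /qq' ->|qv] := orbN (q (pfst st) <= 1).
  by right.
rewrite (negbTE qv).
do 4![case: (_ =P _ :> nat) => _; first by right].
by case: (_ =P 4) => _; [left|right].
Qed.

(** If a step under [q] stands still, the whole run stays there, so the stack was already empty and
    [q'] stands still too. In all other steps the two machines agree. *)
Lemma iter_extends q q' n st : extends q q' ->
  psnd (iter n (step q) st) = 0 -> iter n (step q') st = iter n (step q) st.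
Proof.
move=> qq'; elim: n st => [//|n IH] st; rewrite !iterSr.
have [E|->] := step_extends st qq'; last exact: IH.
have Eit m : iter m (step q) st = st by elim: m => //= m ->.
rewrite E Eit => st0; suff: iter n.+1 (step q') st = st by rewrite iterSr.
by elim: n.+1 => //= m ->; rewrite /step st0.
Qed.

(* [2] stands for an undefined answer, on which the machine is stuck. *)
Definition bits_oracle (t i a : nat) : nat :=
  if a < t then nat_of_bool (odd (iter a half i)) else 2.

(* Least significant bit first. *)
Fixpoint prefix_num (b : nat -> bool) (t : nat) : nat :=
  if t is t'.+1 then nat_of_bool (b 0) + (prefix_num (b \o succn) t').*2 else 0.

Lemma prefix_num_lt b t : prefix_num b t < 2 ^ t.
Proof.
elim: t b => //= t IH b; have := IH (b \o succn); rewrite expnS.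
by case: (b 0) => /=; lia.
Qed.

Lemma bits_prefix_num b t a : a < t -> odd (iter a half (prefix_num b t)) = b a.
Proof.
elim: t a b => // t IH [|a] b /=; first by rewrite oddD odd_double addbF oddb.
by rewrite ltnS => at_; rewrite -iterS iterSr half_bit_double IH.
Qed.

Lemma bits_oracle_mono b t t' : t <= t' ->
  extends (bits_oracle t (prefix_num b t)) (bits_oracle t' (prefix_num b t')).
Proof.
move=> tt' a; rewrite /bits_oracle; case: ltnP => // at_ _.
by rewrite (leq_trans at_ tt') !bits_prefix_num// (leq_trans at_ tt').
Qed.

(** The use principle: each step queries at most the position given by the current value, so [n]
    steps see only finitely many bits of [b]. *)
Lemma iter_bits_oracle b n st : exists t0, forall t, t0 <= t ->
  iter n (step (bits_oracle t (prefix_num b t))) st = iter n (step (fun i => b i)) st.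
Proof.
elim: n st => [|n IH] st; first by exists 0.
have [t0 H] := IH (step (fun i => b i) st); exists (maxn t0 (pfst st).+1) => t.
rewrite geq_max => /andP[tt0 vt]; rewrite !iterSr -(H t tt0); congr iter.
rewrite /step; case: eqP => // _; rewrite /exec /bits_oracle vt.
by rewrite bits_prefix_num// leq_b1.
Qed.

(** The same [t] bounds the number of steps and the number of known oracle bits, so that at time [t]
    only 2^t oracles [i] have to be distinguished. *)
Definition run (e a t i : nat) : nat := iter t (step (bits_oracle t i)) <<a, push e 0>>.

Lemma run_complete b c a y : code_eval b c a y ->
  exists t, run (code_num c) a t (prefix_num b t) = <<y, 0>>.
Proof.
move=> /(@machine_complete _ _ _ _ 0)[n Hn].
have [t0 Ht0] := iter_bits_oracle b n <<a, push (code_num c) 0>>.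
exists (t0 + n); rewrite /run iterD Ht0 ?leq_addr// Hn; exact: iter_halt.
Qed.

Lemma run_mono b e a t t' y : t <= t' -> run e a t (prefix_num b t) = <<y, 0>> ->
  run e a t' (prefix_num b t') = <<y, 0>>.
Proof.
move=> tt' H; rewrite /run -(subnK tt') iterD.
have -> : iter t (step (bits_oracle (t' - t + t) (prefix_num b (t' - t + t))))
    <<a, push e 0>> = <<y, 0>>; last exact: iter_halt.
rewrite -H; apply: (iter_extends (q := bits_oracle t (prefix_num b t))).
  by apply: bits_oracle_mono; rewrite subnK.
by rewrite -/(run e a t _) H pairK.
Qed.

Lemma run_inj b e a t t' y y' : run e a t (prefix_num b t) = <<y, 0>> ->
  run e a t' (prefix_num b t') = <<y', 0>> -> y = y'.
Proof.
move=> /(run_mono (leq_maxl t t')) H /(run_mono (leq_maxr t t')).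
by rewrite H => /(congr1 Cantor.of_nat); rewrite !pairK => -[].
Qed.

Lemma crec_run e a t i : crec e -> crec a -> crec t -> crec i ->
  crec (fun p => run (e p) (a p) (t p) (i p)).
Proof.
move=> He Ha Ht Hi.
apply: (crec_iter (f := fun p => step (bits_oracle (t p) (i p)))) => //.
  by rewrite /push; crec.
have Ht' : crec (fun p => t (pfst p)) by apply: crec_comp Ht _; crec.
have Hi' : crec (fun p => i (pfst p)) by apply: crec_comp Hi _; crec.
have Hq : crec (fun p => bits_oracle (t (pfst p)) (i (pfst p)) (pfst (psnd p))).
  rewrite /bits_oracle; crec.
  apply: (crec_iter (f := fun=> half)); crec.
by rewrite /step /exec /push; crec.
Qed.

(** Here [n] is <<e, J>, s>; the condition that the fraction of prefixes of length [t] with output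
    [s] exceeds 1/J is cleared of denominators. *)
Definition threshold (n t : nat) : bool :=
  let e := pfst (pfst n) in let J := psnd (pfst n) in
  2 ^ t < J * \sum_(i < 2 ^ t) (run e (pfst n) t i == <<psnd n, 0>>).

Lemma crec_threshold n t : crec n -> crec t -> crec (fun p => threshold (n p) (t p)).
Proof.
move=> Hn Ht; rewrite /threshold; crec.
have Ht' : crec (fun p => t (pfst p)) by apply: crec_comp Ht _; crec.
have Hn' : crec (fun p => n (pfst p)) by apply: crec_comp Hn _; crec.
apply: (crec_sum (f := fun p i =>
  run (pfst (pfst (n p))) (pfst (n p)) (t p) i == <<psnd (n p), 0>>)); crec.
by apply: crec_run; crec.
Qed.

Local Open Scope classical_set_scope.
Local Open Scope ring_scope.

(** * Cantor space and the fair-coin measure *)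

Lemma mkseq_eqP (T : eqType) (f g : nat -> T) k :
  mkseq f k = mkseq g k <-> forall i, (i < k)%N -> f i = g i.
Proof.
split=> [E i ik|E]; first by rewrite -(nth_mkseq (f 0%N) f ik) E nth_mkseq.
by apply/eq_in_map => i; rewrite mem_iota => /andP[_]; exact: E.
Qed.

Lemma cylinderP (b b' : cantor) k :
  cylinder (mkseq b k) b' <-> forall i, (i < k)%N -> b' i = b i.
Proof. by rewrite /cylinder /= size_mkseq mkseq_eqP. Qed.

Lemma nbhs_cylinder (b : cantor_space) k :
  nbhs b (cylinder (mkseq b k) : set cantor_space).
Proof.
have -> : (cylinder (mkseq b k) : set cantor_space) =
    [set b' | forall i, (i < k)%N -> b' i = b i].
  by apply/seteqP; split => b' /cylinderP.
elim: k => [|k IH]; first by apply: filterE => b' i; rewrite ltn0.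
have pk : nbhs b [set b' : cantor_space | b' k = b k].
  apply: (@proj_continuous nat (fun=> bool) k b [set b k]).
  exact: discrete_set1.
apply: filterS (filterI IH pk) => b' [H Hk] i.
by rewrite ltnS leq_eqVlt => /orP[/eqP -> //|]; exact: H.
Qed.

(** The filter generated by the cylinders around [b] converges to [b] in each coordinate, hence in
    the product topology. *)
Lemma nbhs_cylinderP (b : cantor_space) (U : set cantor_space) :
  nbhs b U -> exists k, (cylinder (mkseq b k) : set cantor_space) `<=` U.
Proof.
pose F := filter_from [set: nat] (fun k => cylinder (mkseq b k) : set cantor_space).
have FF : Filter F.
  apply: filter_from_filter; first by exists 0%N.
  move=> i j _ _; exists (maxn i j) => // b' /cylinderP H.
  by split; apply/cylinderP => l Hl; apply: H; rewrite leq_max Hl ?orbT.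
have : F --> b.
  apply/(@pointwise_cvgP nat bool F b FF) => t U' /= /nbhs_singleton Ub.
  exists t.+1 => // b' /cylinderP /(_ t (ltnSn t)) E.
  by rewrite /= E.
by move=> + bU => /(_ U bU)[k _ kU]; exists k.
Qed.

(** * Measurability of predicates built with connectives and countable quantifiers *)

Section measurable_predicates.
Context d (T : measurableType d).

Lemma measurable_cst_prop (Q : Prop) : measurable [set _ : T | Q].
Proof.
have [q|nq] := pselect Q.
  by rewrite (_ : mkset _ = setT)//; apply/seteqP; split.
by rewrite (_ : mkset _ = set0)//; apply/seteqP; split.
Qed.

Lemma measurable_conj (F G : T -> Prop) : measurable [set t | F t] ->
  measurable [set t | G t] -> measurable [set t | F t /\ G t].
Proof. exact: measurableI. Qed.

Lemma measurable_exists (I : countType) (F : I -> T -> Prop) :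
  (forall i, measurable [set t | F i t]) -> measurable [set t | exists i, F i t].
Proof.
move=> mF; rewrite (_ : mkset _ =
    \bigcup_n [set t | exists2 i, unpickle n = Some i & F i t]).
  apply: bigcup_measurable => n _; case: (unpickle n) => [i|].
    rewrite (_ : mkset _ = [set t | F i t])//.
    by apply/seteqP; split => t /= => [[_ [<-]]|Fi] //; exists i.
  by rewrite (_ : mkset _ = set0)//; apply/seteqP; split => t //= [].
apply/seteqP; split => t /= => [[i Fi]|[n _ [i _ Fi]]]; last by exists i.
by exists (pickle i) => //; exists i => //; rewrite pickleK.
Qed.

Lemma measurable_neg (F : T -> Prop) :
  measurable [set t | F t] -> measurable [set t | ~ F t].
Proof. exact: measurableC. Qed.

Lemma measurable_forall (I : countType) (F : I -> T -> Prop) :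
  (forall i, measurable [set t | F i t]) -> measurable [set t | forall i, F i t].
Proof.
move=> mF; rewrite (_ : mkset _ = [set t | ~ exists i, ~ F i t]).
  by apply/measurable_neg/measurable_exists => i; exact: measurable_neg.
apply/seteqP; split => t /= H; first by move=> [i]; apply.
by move=> i; apply: contrapT => Fi; apply: H; exists i.
Qed.

Lemma measurable_imply (Q : Prop) (F : T -> Prop) :
  measurable [set t | F t] -> measurable [set t | Q -> F t].
Proof.
move=> mF; have [q|nq] := pselect Q.
  rewrite (_ : mkset _ = [set t | F t])//.
  by apply/seteqP; split => t /= H //; exact: H.
by rewrite (_ : mkset _ = setT)//; apply/seteqP; split => t //= _ /nq.
Qed.

(** Open sets generate the sigma-algebra, and an open set is the union of the cylinders it contains,
    of which there are only countably many. *)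
Lemma measurable_fun_cantor (f : T -> cantor) :
  (forall i, measurable [set t | f t i]) -> measurable_fun setT f.
Proof.
move=> mf; apply: (@measurability _ _ T cantor setT f (@open cantor_space)) => //.
move=> _ [U oU <-]; rewrite setTI.
rewrite (_ : _ @^-1` _ = [set t | exists x : seq bool,
    (cylinder x `<=` U) /\ forall i, (i < size x)%N -> f t i = nth false x i]).
  apply: measurable_exists => x; apply: measurable_conj.
    exact: measurable_cst_prop.
  apply: measurable_forall => i; apply: measurable_imply.
  case: (nth false x i); first exact: mf.
  rewrite (_ : mkset _ = [set t | ~ f t i]); first exact/measurable_neg/mf.
  by apply/seteqP; split => t /=; [move=> ->|move/negP/negbTE].
apply/seteqP; split => t /= => [Ut|[x [xU H]]].
  have [k kU] := nbhs_cylinderP (open_nbhs_nbhs (conj oU Ut)).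
  exists (mkseq (f t) k); split=> // i; rewrite size_mkseq => ik.
  by rewrite nth_mkseq.
apply: xU; rewrite /cylinder /=; apply: (@eq_from_nth _ false) => [|i].
  exact: size_mkseq.
by rewrite size_mkseq => ix; rewrite nth_mkseq// H.
Qed.

End measurable_predicates.

Lemma measurable_coord (i : nat) : measurable [set b : cantor | b i].
Proof.
apply: sub_sigma_algebra; rewrite openE => b /= bi.
apply: filterS (nbhs_cylinder b i.+1) => b' /cylinderP /(_ i (ltnSn i)).
by move=> /= ->.
Qed.

Lemma measurable_coord_eq (i : nat) (c : bool) : measurable [set b : cantor | b i = c].
Proof.
case: c; first exact: measurable_coord.
rewrite (_ : mkset _ = [set b : cantor | ~ b i]).
  by apply: measurable_neg; exact: measurable_coord.
by apply/seteqP; split => b /=; [move=> ->|move/negP/negbTE].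
Qed.

Lemma measurable_cylinder (x : seq bool) : measurable (cylinder x).
Proof.
rewrite (_ : cylinder x =
    [set b : cantor | forall i, (i < size x)%N -> b i = nth false x i]).
  apply: measurable_forall => i; apply: measurable_imply.
  exact: measurable_coord_eq.
apply/seteqP; split => b /= => [<- i|H].
  by rewrite size_mkseq => ix; rewrite nth_mkseq.
apply: (@eq_from_nth _ false) => [|i]; first exact: size_mkseq.
by rewrite size_mkseq => ix; rewrite nth_mkseq// H.
Qed.

(** * The fair-coin measure as the law of the binary digits of a uniform real *)

Section fair_coin.
Context (R : realType).

(** For [u] in [0, 1) this is the binary expansion: digit [k] is the parity of the integer part of u
    * 2^(k+1). *)
Definition digits (u : measurableTypeR R) : cantor :=
  fun k => odd (Num.truncn (u * 2 ^+ k.+1)).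

Lemma measurable_digits : measurable_fun [set: measurableTypeR R] digits.
Proof.
apply: measurable_fun_cantor => k /=.
have mle n : measurable [set u : measurableTypeR R | (Num.truncn (u * 2 ^+ k.+1) <= n)%N].
  rewrite (_ : mkset _ = `]-oo, (n.+1%:R / 2 ^+ k.+1)[%classic) //.
  apply/seteqP; split => u /=;
    by rewrite in_itv /= truncn_le_nat ltr_pdivlMr// exprn_gt0.
(* Having the value [n] means being at most [n] but not at most [n.-1]; oddness excludes 0, where
   [n.-1] would be [n] itself. *)
rewrite (_ : mkset _ = [set u : R | exists n, odd n /\
   ((Num.truncn (u * 2 ^+ k.+1) <= n)%N /\ ~ (Num.truncn (u * 2 ^+ k.+1) <= n.-1)%N)]).
  apply: measurable_exists => n; apply: measurable_conj; first exact: measurable_cst_prop.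
  by apply: measurable_conj => //; apply: measurable_neg.
apply/seteqP; split => u; rewrite /digits /=.
  case E : (Num.truncn _) => [//|n] on; exists n.+1; split=> //.
  by split=> //=; rewrite ltnn.
move=> [n [on [H1 /negP H2]]]; case: n on H1 H2 => // n on H1 H2.
by rewrite (_ : Num.truncn _ = n.+1)//; apply: anti_leq; rewrite H1 ltnNge.
Qed.

Lemma half_truncn (y : R) : 0 <= y -> (Num.truncn (y * 2))./2 = Num.truncn y.
Proof.
move=> y0; apply/esym/truncn_def; set m := Num.truncn (y * 2).
have /andP[] : m%:R <= y * 2 < m.+1%:R by apply: truncn_itv; rewrite mulr_ge0.
have mE : m%:R = (odd m)%:R + 2 * (m./2)%:R :> R.
  by rewrite -[LHS](congr1 _ (odd_double_half m)) natrD -muln2 natrM mulrC.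
by rewrite -!natr1 mE; case: odd => /= H1 H2; apply/andP; split; lra.
Qed.

(** Most significant bit first, with accumulator [n]: started at 0, it gives the numerator of the
    left end of the dyadic interval that belongs to [x]. *)
Fixpoint big_endian (x : seq bool) (n : nat) : nat :=
  if x is c :: x' then big_endian x' (c + n.*2) else n.

Lemma big_endian_rcons x c n : big_endian (rcons x c) n = (c + (big_endian x n).*2)%N.
Proof. by elim: x n => //= c' x IH n. Qed.

Lemma big_endian_lt x : (big_endian x 0 < 2 ^ size x)%N.
Proof.
elim/last_ind: x => // x c IH; rewrite big_endian_rcons size_rcons expnS.
by case: c; lia.
Qed.

(** Induction from the right end of [x]: the integer part at the next scale has the new digit as its
    parity, and its half is the previous integer part. *)
Lemma cylinder_digits (x : seq bool) (u : R) : 0 <= u < 1 ->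
  cylinder x (digits u) <-> Num.truncn (u * 2 ^+ size x) = big_endian x 0.
Proof.
move=> /andP[u0 u1]; elim/last_ind: x => [|x c IH]; rewrite /cylinder /=.
  rewrite expr0 mulr1; split=> // _.
  by apply: truncn_def; rewrite u0.
rewrite size_rcons mkseqS big_endian_rcons.
have hE := @half_truncn (u * 2 ^+ size x) (mulr_ge0 u0 (exprn_ge0 _ (ler0n _ _))).
rewrite -mulrA -exprSr in hE.
split=> [/eqP|E].
  rewrite eqseq_rcons => /andP[/eqP /IH xE /eqP <-].
  by rewrite /digits -{1}[LHS]odd_double_half hE xE.
have /IH -> : Num.truncn (u * 2 ^+ size x) = big_endian x 0.
  by rewrite -hE E half_bit_double.
by rewrite /digits E oddD odd_double addbF oddb.
Qed.

(** The uniform density lives on the closed interval; the null point 1 is dropped because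
    [cylinder_digits] requires u < 1. *)
Lemma uniform_prob_unit (A : set (measurableTypeR R)) : measurable A ->
  uniform_prob (@ltr01 R) A = lebesgue_measure (A `&` `[0, 1[%classic).
Proof.
move=> mA; rewrite /uniform_prob integral_uniform_pdf.
have mA1 : measurable (A `&` `[0, 1]%classic) by exact: measurableI.
rewrite (eq_integral (fun=> 1%:E)); last first.
  move=> u; rewrite inE /= => -[_]; rewrite in_itv /= /uniform_pdf => ->.
  by rewrite subr0 invr1.
rewrite integral_cst// mul1e.
rewrite (_ : A `&` `[0, 1]%classic = (A `&` `[0, 1[%classic) `|` (A `&` [set 1])).
  apply: measureU0; [exact: measurableI|exact: measurableI|].
  apply: subset_measure0 (@lebesgue_measure_set1 R 1) => //; exact: measurableI.
apply/seteqP; split => u /=; rewrite !in_itv /=.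
  move=> [Au /andP[u0]]; rewrite le_eqVlt => /orP[/eqP u1|u1]; first by right.
  by left; rewrite u0.
move=> [[Au /andP[u0 /ltW u1]]|[Au u1]]; split=> //; first by rewrite u0.
by rewrite u1 ler01 lexx.
Qed.

(** Push the uniform law forward along [digits]: within [0, 1) the preimage of a cylinder is a
    dyadic interval of length 2^-|x|. *)
Lemma fair_coin_exists : exists lam : probability cantor R,
  forall x, lam (cylinder x) = (2 ^- size x)%:E.
Proof.
pose D : {mfun measurableTypeR R >-> cantor} := mfun_Sub (mem_set measurable_digits).
exists (distribution (uniform_prob (@ltr01 R)) D) => x.
rewrite /distribution /pushforward /=.
have mx : measurable (digits @^-1` cylinder x).
  rewrite -[_ @^-1` _]setTI; apply: measurable_digits => //.
  exact: measurable_cylinder.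
rewrite uniform_prob_unit//.
have p0 : (0 : R) < 2 ^+ size x by rewrite exprn_gt0.
have bl : (big_endian x 0).+1%:R <= 2 ^+ size x :> R.
  by rewrite -natrX ler_nat big_endian_lt.
rewrite (_ : _ `&` _ = `[(big_endian x 0)%:R / 2 ^+ size x,
    (big_endian x 0).+1%:R / 2 ^+ size x[%classic); last first.
  apply/seteqP; split => u /=; rewrite !in_itv /=.
    move=> [+ u01] => /(cylinder_digits _ u01) E.
    have /andP[u0 _] := u01.
    rewrite ler_pdivrMr// ltr_pdivlMr// -E; apply: truncn_itv.
    by rewrite mulr_ge0// ltW.
  rewrite ler_pdivrMr// ltr_pdivlMr// => H.
  have u01 : 0 <= u < 1.
    case/andP: H => H1 H2; rewrite -(pmulr_lge0 _ p0) (le_trans _ H1)//=.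
    by rewrite -(ltr_pM2r p0) mul1r (lt_le_trans H2).
  by split=> //; apply/(cylinder_digits _ u01)/truncn_def.
rewrite lebesgue_measure_itv /= lte_fin ltr_pM2r ?invr_gt0// ltr_nat ltnSn.
by rewrite -EFinB -mulrBl -natr1 [X in X / _]addrAC subrr add0r mul1r.
Qed.

End fair_coin.

(** * The joint law *)

Section joint_law.
Context (R : realType).

Lemma half_powers k : 2 ^- k.+1 + 2 ^- k.+1 = 2 ^- k :> R.
Proof. by rewrite exprS invfM; lra. Qed.

Lemma law_exists d d' (T : measurableType d) (T' : measurableType d')
    (P : probability T R) (f : T -> T') : measurable_fun setT f ->
  exists Q : probability T' R, forall A, Q A = P (f @^-1` A).
Proof.
move=> mf; pose D : {mfun T >-> T'} := mfun_Sub (mem_set mf).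
by exists (distribution P D).
Qed.

Lemma measurable_fun_nat d (T : measurableType d) (f : T -> nat) :
  (forall m, measurable [set t | f t = m]) -> measurable_fun setT f.
Proof.
move=> mf _ A _; rewrite setTI.
rewrite (_ : _ @^-1` _ = [set t | exists m, A m /\ f t = m]).
  apply: measurable_exists => m.
  apply: measurable_conj; last exact: mf.
  exact: measurable_cst_prop.
by apply/seteqP; split => t /= => [At|[m [Am ->]]//]; exists (f t).
Qed.

Context (lam : probability cantor R).
Hypothesis lamE : forall x, lam (cylinder x) = (2 ^- size x)%:E.

(** The set lies in the cylinders of [k] zeros for all [k]. It is the exceptional set in
    [weights_exist], where a first true bit is sought. *)
Lemma lam_zeros : lam [set b : cantor | forall i, b i = false] = 0%E.
Proof.
apply/eqP; rewrite eq_le measure_ge0 andbT; apply/lee_addgt0Pr => e e0.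
rewrite add0e; have [k ke] : exists k, (2 ^- k : R) <= e.
  have [k _ /(_ k (leqnn k)) /ltW] := near_infty_natSinv_expn_lt (PosNum e0).
  by exists k; rewrite -div1r.
apply: (@le_trans _ _ (lam (cylinder (nseq k false)))).
  apply: le_measure; rewrite ?inE.
  - by apply: measurable_forall => i; exact: measurable_coord_eq.
  - exact: measurable_cylinder.
  move=> b /= b0; apply: (@eq_from_nth _ false); rewrite size_nseq size_mkseq// => i ik.
  by rewrite nth_mkseq// nth_nseq ik b0.
by rewrite lamE size_nseq lee_fin.
Qed.

(** Take for [n] the position of the first true bit of a fair sequence and for [c] the bit after it:
    this fixes n + 2 bits. *)
Lemma weights_exist : exists Q : probability nat R,
  forall n (c : bool), Q [set (c + n.*2)%N] = (2 ^- n.+2)%:E.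
Proof.
pose W (b : cantor) : nat := if pselect (exists n, b n) is left e
  then let n := ex_minn e in (b n.+1 + n.*2)%N else 0%N.
pose x n c := rcons (rcons (nseq n false) true) c.
(* The all-false sequence is sent to the default 0, which adds a null set to the preimage of 0. *)
have WE n (c : bool) : W @^-1` [set (c + n.*2)%N] = cylinder (x n c) `|`
    [set b : cantor | (c + n.*2 = 0)%N /\ forall i, b i = false].
  apply/seteqP; split => b /=.
    rewrite /W; case: pselect => [e|ne].
      case: ex_minnP => m bm mmin E; left.
      have mn : m = n by case: (b m.+1) c E => -[]; lia.
      have cb : b m.+1 = c by subst; case: (b n.+1) c E => -[]; lia.
      rewrite /cylinder /x /= !size_rcons size_nseq !mkseqS -mn bm cb.
      congr (rcons (rcons _ _) _); apply: (@eq_from_nth _ false).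
        by rewrite size_mkseq size_nseq.
      move=> i; rewrite size_mkseq => im; rewrite nth_mkseq// nth_nseq im.
      by apply: contraTF im => /mmin; rewrite -leqNgt.
    move=> E; right; split=> // i.
    by case bi : (b i) => //; case: ne; exists i.
  case; last first.
    move=> [-> b0]; rewrite /W; case: pselect => // e.
    by case: ex_minnP => m; rewrite b0.
  rewrite /cylinder /x /= !size_rcons size_nseq !mkseqS => /eqP.
  rewrite !eqseq_rcons => /andP[/andP[/eqP b0 /eqP bn] /eqP bc].
  rewrite /W; case: pselect => [e|]; last by case; exists n; rewrite bn.
  case: ex_minnP => m bm mmin.
  suff -> : m = n by rewrite bc.
  apply: anti_leq; rewrite mmin ?bn//= leqNgt; apply/negP => mn.
  by move: bm; rewrite -(nth_mkseq false b mn) b0 nth_nseq mn.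
have mN (E : Prop) : measurable [set b : cantor | E /\ forall i, b i = false].
  apply: measurable_conj; first exact: measurable_cst_prop.
  by apply: measurable_forall => i; exact: measurable_coord_eq.
have mW : measurable_fun setT W.
  apply: measurable_fun_nat => m; rewrite -(odd_double_half m).
  rewrite -/(W @^-1` [set (odd m + m./2.*2)%N]) WE.
  by apply: measurableU => //; exact: measurable_cylinder.
have [Q QE] := law_exists lam mW; exists Q => n c.
rewrite QE WE measureU0//; last 2 first.
- exact: measurable_cylinder.
- apply: subset_measure0 lam_zeros => //; last by move=> b [].
  by apply: measurable_forall => i; exact: measurable_coord_eq.
by apply: etrans (lamE _) _; rewrite /x !size_rcons size_nseq.
Qed.

(** A bit outside the prefix is still fair. Induction on the distance from the end of [x] to [s],
    splitting the cylinder at its next bit. *)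
Lemma lam_cylinder_coord x s c : (size x <= s)%N ->
  lam (cylinder x `&` [set b | b s = c]) = (2 ^- (size x).+1)%:E.
Proof.
move=> xs; rewrite -(subnKC xs); move: (s - size x)%N => d {s xs}.
have cyl_rcons y c' : cylinder (rcons y c') = cylinder y `&` [set b | b (size y) = c'].
  apply/seteqP; split => b; rewrite /cylinder /= size_rcons mkseqS.
    by move=> /eqP; rewrite eqseq_rcons => /andP[/eqP ? /eqP ?].
  by move=> [-> ->].
elim: d x => [|d IH] x; first by rewrite addn0 -cyl_rcons lamE size_rcons.
set E : set cantor := [set b | _].
have mE : measurable E by exact: measurable_coord_eq.
have -> : cylinder x `&` E =
    (cylinder (rcons x true) `&` E) `|` (cylinder (rcons x false) `&` E).
  rewrite !cyl_rcons -setIUl; congr (_ `&` _); apply/seteqP; split => b /=.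
    by move=> xb; case: (b (size x)); [left|right].
  by case=> -[].
have mE' c' : measurable (cylinder (rcons x c') `&` E).
  by apply: measurableI => //; exact: measurable_cylinder.
apply: (etrans (measureU lam (mE' true) (mE' false) _)).
  by rewrite !cyl_rcons; apply/seteqP; split => b //= [[[_ ->] _] [[]]].
have lE c' : lam (cylinder (rcons x c') `&` E) = (2 ^- (size x).+2)%:E.
  by have := IH (rcons x c'); rewrite size_rcons addSnnS.
apply: (etrans (congr2 +%E (lE true) (lE false))); rewrite -EFinD; congr EFin.
exact: half_powers.
Qed.

Context (Q : probability nat R).
Hypothesis QE : forall n (c : bool), Q [set (c + n.*2)%N] = (2 ^- n.+2)%:E.
Context (h : nat -> option nat).

Let prodE (A : set nat) (B : set cantor) : measurable A -> measurable B ->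
  (Q \x lam)%E (A `*` B) = (Q A * lam B)%E.
Proof. exact: product_measure1E. Qed.

(** The joint law is studied for any partial function [h]; [halting_time] is substituted at the end.
    Only the parity of [m] can change, so [m./2] always remains the number of the computation. *)
Definition reveal (m : nat) (b : cantor) : nat :=
  if h m./2 is Some s then (b s + m./2.*2)%N else m.

Lemma half_reveal m b : (reveal m b)./2 = m./2.
Proof. by rewrite /reveal; case: (h _) => // s; rewrite half_bit_double. Qed.

Lemma odd_reveal m b :
  odd (reveal m b) = if h m./2 is Some s then b s else odd m.
Proof. by rewrite /reveal; case: (h _) => // s; rewrite oddD odd_double addbF oddb. Qed.

Lemma revealE m b n (c : bool) : reveal m b = (c + n.*2)%N <->
  m./2 = n /\ (if h n is Some s then b s else odd m) = c.
Proof.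
split=> [E|[mn E]].
  have En : m./2 = n by rewrite -(half_reveal m b) E half_bit_double.
  by split=> //; rewrite -En -odd_reveal E oddD odd_double addbF oddb.
by rewrite -(odd_double_half (reveal m b)) half_reveal odd_reveal mn E.
Qed.

(** On each of the countably many slices with fixed [m], the first component depends on at most one
    bit of [b]. *)
Lemma measurable_joint :
  measurable_fun setT (fun mb : nat * cantor => (reveal mb.1 mb.2, mb.2)).
Proof.
apply: measurable_fun_pair => //=.
apply: measurable_fun_nat => v.
rewrite (_ : mkset _ = [set mb : nat * cantor | exists m, mb.1 = m /\ reveal m mb.2 = v]).
  apply: measurable_exists => m.
  rewrite (_ : mkset _ = [set m] `*` [set b | reveal m b = v]).
    apply: measurableX => //; rewrite -(odd_double_half v).
    rewrite (_ : mkset _ = [set b : cantor | m./2 = v./2 /\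
      (if h v./2 is Some s then b s else odd m) = odd v]).
      apply: measurable_conj; first exact: measurable_cst_prop.
      by case: (h _) => [s|]; [exact: measurable_coord_eq|exact: measurable_cst_prop].
    by apply/seteqP; split => b /= /revealE.
  by apply/seteqP; split => -[].
by apply/seteqP; split => mb /= => [<-|[m [-> //]]]; exists mb.1.
Qed.

Lemma joint_exists : exists P : probability (nat * cantor)%type R,
  forall A, P A = (Q \x lam)%E ((fun mb => (reveal mb.1 mb.2, mb.2)) @^-1` A).
Proof. exact: (law_exists (Q \x lam)%E measurable_joint). Qed.

Context (P : probability (nat * cantor)%type R).
Hypothesis PE : forall A,
  P A = (Q \x lam)%E ((fun mb => (reveal mb.1 mb.2, mb.2)) @^-1` A).

Lemma joint_setT T : measurable T -> P ([set: nat] `*` T) = lam T.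
Proof.
move=> mT; rewrite PE (_ : _ @^-1` _ = [set: nat] `*` T).
  by rewrite prodE// probability_setT mul1e.
by apply/seteqP; split.
Qed.

Lemma Q_half n : Q [set m | m./2 = n] = (2 ^- n.+1)%:E.
Proof.
rewrite (_ : mkset _ = [set (true + n.*2)%N] `|` [set (false + n.*2)%N]).
  apply: (etrans (measureU Q _ _ _)) => //.
    by apply/seteqP; split => m //= [-> ]; rewrite add0n; lia.
  apply: (etrans (congr2 +%E (QE n true) (QE n false))); rewrite -EFinD; congr EFin.
  exact: half_powers.
apply/seteqP; split => m /=; last first.
  by case=> ->; [exact: (half_bit_double n true)|exact: (half_bit_double n false)].
by move=> <-; case E : (odd m); [left|right]; have /esym := odd_double_half m; rewrite E.
Qed.

(** A mass in units of 2^-(n + 2 + |x|). It is 1 both if [n] never halts and if the revealed bit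
    lies beyond [x], so that finding it takes a search only up to |x|. *)
Definition weight (n : nat) (c : bool) (x : seq bool) : nat :=
  if h n is Some s
  then if (s < size x)%N then (nth false x s == c).*2 else 1%N
  else 1%N.

Lemma joint_cylinder n (c : bool) x : P ([set (c + n.*2)%N] `*` cylinder x) =
  ((weight n c x)%:R * 2 ^- (n.+2 + size x))%:E.
Proof.
have mx := measurable_cylinder x.
rewrite PE /weight; case hn : (h n) => [s|]; last first.
  rewrite (_ : _ @^-1` _ = [set (c + n.*2)%N] `*` cylinder x).
    by rewrite prodE// QE lamE -EFinM mul1r -invfM -exprD.
  apply/seteqP; split => -[m b] /= [E xb]; split=> //.
    move/revealE : E; rewrite hn => -[<- <-]; exact/esym/odd_double_half.
  by apply/revealE; rewrite hn E half_bit_double oddD odd_double addbF oddb.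
(* When [n] halts, the drawn parity is overwritten: both draws with half [n] count, and the
   condition falls on the bit [b s]. *)
rewrite (_ : _ @^-1` _ = [set m | m./2 = n] `*` (cylinder x `&` [set b | b s = c])).
  rewrite prodE//; last by apply: measurableI => //; exact: measurable_coord_eq.
  rewrite Q_half; case: ltnP => sx; last first.
    rewrite lam_cylinder_coord// -EFinM mul1r -invfM -exprD; congr (_^-1%:E).
    by congr (_ ^+ _); lia.
  have nx b : cylinder x b -> nth false x s = b s.
    by move=> xb; rewrite -[in LHS]xb nth_mkseq.
  have -> : cylinder x `&` [set b | b s = c] =
      if nth false x s == c then cylinder x else set0.
    apply/seteqP; split => b /=; first by move=> [xb <-]; rewrite (nx b xb) eqxx.
    by case: eqP => // <- xb; rewrite (nx b xb).
  case: eqP => _; last by rewrite measure0 mule0 mul0r.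
  rewrite lamE -EFinM; congr EFin; rewrite -invfM -exprD !addSn.
  by rewrite [in RHS]exprS [in RHS]invfM mulrA mulfV ?mul1r ?pnatr_eq0.
apply/seteqP; split => -[m b] /=.
  by move=> [/revealE]; rewrite hn => -[].
by move=> [mn [xb bs]]; split=> //; apply/revealE; rewrite hn.
Qed.

(** The candidate for the conditional measure: the law of [reveal m b] for fixed [b] and [m] drawn
    from [Q]. *)
Definition limit_cond (S : set nat) (b : cantor) : R := fine (Q [set m | S (reveal m b)]).

Lemma limit_cond_set1 n (c : bool) b : limit_cond [set (c + n.*2)%N] b =
  (if h n is Some s then (b s == c).*2 else 1%N)%:R * 2 ^- n.+2.
Proof.
rewrite /limit_cond; case hn : (h n) => [s|]; last first.
  rewrite (_ : mkset _ = [set (c + n.*2)%N]) ?QE ?mul1r//.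
  apply/seteqP; split => m /= => [/revealE|->].
    by rewrite hn => -[<- <-]; exact/esym/odd_double_half.
  by apply/revealE; rewrite hn half_bit_double oddD odd_double addbF oddb.
case: eqP => bs.
  rewrite (_ : mkset _ = [set m | m./2 = n]).
    by rewrite Q_half /= [in RHS]exprS invfM mulrA mulfV ?mul1r ?pnatr_eq0.
  by apply/seteqP; split => m /= => [/revealE[]//|mn]; apply/revealE; rewrite hn.
rewrite (_ : mkset _ = set0) ?measure0 ?mul0r//.
by apply/seteqP; split => m //= /revealE; rewrite hn => -[_ /bs].
Qed.

Definition tail (M : nat) : R := fine (Q [set m | (M <= m./2)%N]).

Lemma cvg_tail : tail M @[M --> \oo] --> 0.
Proof.
pose F M := [set m : nat | (M <= m./2)%N].
have F0 : \bigcap_M F M = set0.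
  by apply/seteqP; split => m //= /(_ m./2.+1 I); rewrite /F /= ltnn.
have : Q (F M) @[M --> \oo] --> Q (\bigcap_M F M).
  apply: (nonincreasing_cvg_mu (mu := Q)) => //.
    by rewrite ltey_eq fin_num_measure.
  by move=> i j ij; apply/subsetPset => m /=; exact: leq_trans.
by rewrite F0 measure0 => /fine_cvg.
Qed.

Lemma bound_halting M : exists k, forall n s, (n < M)%N -> h n = Some s -> (s < k)%N.
Proof.
exists (\max_(n < M) (odflt 0 (h n)).+1)%N => n s nM hn.
apply: leq_trans (leq_bigmax (F := fun n : 'I_M => (odflt 0 (h n)).+1%N) (Ordinal nM)).
by rewrite /= hn.
Qed.

(** On the cylinder, [reveal m] is constant for every [m] with m./2 < M, since any bit it reads has
    index below [k]; the other [m] have mass [tail M]. The bound is uniform in [S] and [b], which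
    serves both convergence and continuity. *)
Lemma cond_ratio_close S b k M :
  (forall n s, (n < M)%N -> h n = Some s -> (s < k)%N) ->
  `|cond_ratio P S b k - limit_cond S b| <= tail M.
Proof.
move=> Hk; set C := cylinder (mkseq b k).
have mC : measurable C by exact: measurable_cylinder.
pose q := [set m | S (reveal m b)]; pose L := [set m | (M <= m./2)%N].
have lC : lam C = (2 ^- k)%:E by rewrite lamE size_mkseq.
have finQ A : (Q A = (fine (Q A))%:E) by rewrite fineK// fin_num_measure.
have k0 : 0 < (2 ^- k : R) by rewrite invr_gt0 exprn_gt0.
(* Limit and ratio both lie between the mass of [q] outside [L] and that mass plus [tail M]: [le1]
   and [le2] show it for the limit, [le3] and [le4] for the ratio. *)
have le1 : fine (Q (q `&` ~` L)) <= limit_cond S b.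
  by rewrite -lee_fin -!finQ le_measure ?inE//; exact: subIsetl.
have le2 : limit_cond S b <= fine (Q (q `&` ~` L)) + tail M.
  rewrite -lee_fin EFinD -!finQ (le_trans _ (measureU2 _ _ _))//.
  by rewrite le_measure ?inE// => m qm; have [Lm|Lm] := pselect (L m); [right|left].
have mS : measurable (S `*` C) by exact: measurableX.
have finP : P (S `*` C) = (fine (P (S `*` C)))%:E by rewrite fineK// fin_num_measure.
have sameN m b' : C b' -> ~ L m -> reveal m b' = reveal m b.
  move=> /cylinderP Cb' /negP; rewrite -ltnNge => mM.
  by rewrite /reveal; case hm : (h _) => [s|//]; rewrite Cb'// (Hk _ _ mM hm).
have mG : measurable (
    (fun mb : nat * cantor => (reveal mb.1 mb.2, mb.2)) @^-1` (S `*` C)).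
  by rewrite -[_ @^-1` _]setTI; exact: measurable_joint.
have le3 : fine (Q (q `&` ~` L)) * 2 ^- k <= fine (P (S `*` C)).
  rewrite -lee_fin -finP EFinM -finQ -lC -prodE// PE.
  rewrite le_measure ?inE//; first exact: measurableX.
  by move=> [m b'] /= [[qm Lm] Cb']; split=> //; rewrite sameN.
have le4 : fine (P (S `*` C)) <= (fine (Q (q `&` ~` L)) + tail M) * 2 ^- k.
  rewrite -lee_fin -finP mulrDl EFinD !EFinM -!finQ -lC -!prodE// PE.
  apply: (le_trans _ (measureU2 _ _ _)); [|exact: measurableX|exact: measurableX].
  rewrite le_measure ?inE//; first by apply: measurableU; exact: measurableX.
  move=> [m b'] /= [Sm Cb']; have [Lm|Lm] := pselect (L m); [right|left]; split=> //.
  by split=> //; rewrite /q /= -(sameN _ _ Cb' Lm).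
rewrite /cond_ratio -/C joint_setT// lC /=.
rewrite ler_distl; apply/andP; split.
  rewrite ler_pdivlMr//; apply: le_trans le3; rewrite ler_pM2r//; lra.
rewrite ler_pdivrMr//; apply: le_trans le4 _; rewrite ler_pM2r//; lra.
Qed.

Lemma cvg_cond_ratio S b : cond_ratio P S b k @[k --> \oo] --> limit_cond S b.
Proof.
apply/cvgrPdist_le => e e0.
have [M _ /(_ M (leqnn M)) /= HM] := (cvgrPdist_le _ _).1 cvg_tail e e0.
have [k Hk] := bound_halting M; exists k => // j /= kj.
rewrite distrC; apply: (le_trans (cond_ratio_close (M := M) S b _)).
  by move=> n s nM hn; exact: leq_trans (Hk _ _ nM hn) kj.
by move: HM; rewrite sub0r normrN; exact: le_trans (ler_norm _).
Qed.

Lemma condE S b : cond P S b = limit_cond S b.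
Proof. by apply: cvg_lim => //; exact: cvg_cond_ratio. Qed.

Lemma cond_definedP S b : cond_defined P S b.
Proof.
split; last by apply/cvg_ex; exists (limit_cond S b); exact: cvg_cond_ratio.
move=> k; rewrite joint_setT ?lamE; last exact: measurable_cylinder.
by rewrite gt_eqF// lte_fin invr_gt0 exprn_gt0.
Qed.

(** The ratio at level [k] is the same for all points of the cylinder, and each limit is within e/2
    of it. *)
Lemma continuous_cond S : continuous (cond P S : cantor_space -> R).
Proof.
move=> b; apply/cvgrPdist_le => e e0; have e2 : 0 < e / 2 by rewrite divr_gt0.
have [M _ /(_ M (leqnn M)) /= HM] := (cvgrPdist_le _ _).1 cvg_tail _ e2.
have tM : tail M <= e / 2 by move: HM; rewrite sub0r normrN; exact: le_trans (ler_norm _).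
have [k Hk] := bound_halting M.
apply: filterS (nbhs_cylinder b k) => b' Cb'; rewrite !condE.
have E : mkseq b' k = mkseq b k by apply/mkseq_eqP/cylinderP.
have H1 := cond_ratio_close S b Hk; have H2 := cond_ratio_close S b' Hk.
have Er : cond_ratio P S b' k = cond_ratio P S b k by rewrite /cond_ratio E.
rewrite Er in H2; rewrite distrC in H1.
have := ler_distD (cond_ratio P S b k) (limit_cond S b) (limit_cond S b'); lra.
Qed.

End joint_law.

(** * The diagonal argument *)

Section halting.
Local Open Scope nat_scope.

Definition halting_time (n : nat) : option nat :=
  if pselect (exists t, threshold n t) is left e then Some (ex_minn e) else None.

(** A string with head c and tail code m has code 2m + c + 1, so the predecessor has m as its half
    and c as its parity. The empty string, 0, is a fixed point. *)
Definition str_behead (s : nat) : nat := s.-1./2.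

Definition str_nth (s j : nat) : bool := odd (iter j str_behead s).-1.

(** The iterates are positive as long as bits remain, and the code of a string bounds its length,
    whence the range of the sum. *)
Definition str_size (s : nat) : nat := \sum_(j < s) (0 < iter j str_behead s).

Lemma iter_str_behead x j : iter j str_behead (string_code x) = string_code (drop j x).
Proof.
elim: j x => [|j IH] x; first by rewrite drop0.
rewrite iterSr; case: x => [|c x]; last first.
  by rewrite [drop _ _]/= -IH /str_behead /= addnS addnC half_bit_double.
by rewrite -[str_behead _]/(string_code [::]) IH; case: (j).
Qed.

Lemma str_nthE x j : j < size x -> str_nth (string_code x) j = nth false x j.
Proof.
rewrite /str_nth iter_str_behead => jx; rewrite (drop_nth false)//= addnS.
by rewrite addnC oddD odd_double addbF oddb.
Qed.

Lemma size_string_code x : size x <= string_code x.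
Proof. by elim: x => //= c x IH; lia. Qed.

Lemma sum_ltn s L : \sum_(t < L) (t < s) = minn s L.
Proof.
elim: L => [|L IH]; first by rewrite big_ord0 minn0.
by rewrite big_ord_recr /= IH; case: ltnP; lia.
Qed.

Lemma str_sizeE x : str_size (string_code x) = size x.
Proof.
rewrite /str_size (eq_bigr (fun j : 'I__ => (j < size x : nat))).
  by rewrite sum_ltn; apply/minn_idPl/size_string_code.
move=> j _; rewrite iter_str_behead; congr nat_of_bool.
rewrite -(subn_gt0 j) -size_drop; case: (drop j x) => //= c y.
by rewrite addnS.
Qed.

(** Counts the t < L up to which [n] has not halted. This is the halting time cut off at [L],
    obtained by a bounded search. *)
Definition capped_time (n L : nat) : nat :=
  \sum_(t < L) (\sum_(u < t.+1) threshold n u == 0).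

Lemma capped_timeE n L :
  capped_time n L = if halting_time n is Some s then minn s L else L.
Proof.
rewrite /capped_time /halting_time; case: pselect => [e|ne].
  case: ex_minnP => s hs smin; rewrite -sum_ltn; apply: eq_bigr => t _.
  congr nat_of_bool; rewrite sum_nat_eq0; apply/forallP/idP => [H|ts u].
    rewrite ltnNge; apply/negP => st.
    by have := H (Ordinal (st : s < t.+1)); rewrite /= hs.
  by apply/implyP => _; rewrite eqb0; apply: contraL ts => /smin; case: u => /= u; lia.
rewrite -[RHS](card_ord L) -sum1_card; apply: eq_bigr => t _.
rewrite big1// => u _; case E : (threshold _ _) => //.
by case: ne; exists u.
Qed.

Definition weight_num (v s : nat) : nat :=
  let L := str_size s in let t := capped_time v./2 L in
  if t < L then
    2 * (nat_of_bool (str_nth s t) == nat_of_bool (odd v))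
  else 1.

Lemma weight_numE v x :
  weight_num v (string_code x) = weight halting_time v./2 (odd v) x.
Proof.
rewrite /weight_num /weight str_sizeE capped_timeE.
case: (halting_time _) => [s|]; last by rewrite ltnn.
have -> : (minn s (size x) < size x) = (s < size x) by lia.
case: ltnP => // sx; rewrite str_nthE//.
by case: (nth _ _ _); case: (odd v).
Qed.

Lemma crec_iter_behead f g : crec f -> crec g ->
  crec (fun a => iter (f a) str_behead (g a)).
Proof.
move=> Hf Hg; apply: (crec_iter (f := fun=> str_behead)) => //.
by rewrite /str_behead; crec.
Qed.

Lemma crec_str_size s : crec s -> crec (fun a => str_size (s a)).
Proof.
move=> Hs; apply: (crec_sum (f := fun a j => (0 < iter j str_behead (s a)) : nat)) => //.
have Hs' : crec (fun p => s (pfst p)) by apply: crec_comp Hs _; crec.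
by crec; apply: crec_iter_behead; crec.
Qed.

Lemma crec_weight_num v s : crec v -> crec s -> crec (fun a => weight_num (v a) (s a)).
Proof.
move=> Hv Hs.
have HL := crec_str_size Hs.
have Ht : crec (fun a => capped_time (v a)./2 (str_size (s a))).
  rewrite /capped_time.
  apply: (crec_sum (f := fun a t =>
    (\sum_(u < t.+1) threshold (v a)./2 u == 0) : nat)) => //.
  have Hv' : crec (fun p => v (pfst (pfst p))) by apply: crec_comp Hv _; crec.
  crec; apply: (crec_sum (f := fun p u => (threshold (v (pfst p))./2 u : nat))); crec.
  by apply: crec_threshold; crec.
have Hn : crec (fun a => iter (capped_time (v a)./2 (str_size (s a))) str_behead (s a)).
  exact: crec_iter_behead.
by rewrite /weight_num /str_nth; crec.
Qed.

(* In units of 2^-(n+4), the conditional probability of [2n] is 4 if [n] does not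
   halt and 0 or 8 otherwise; an approximation up to one unit decides between
   [2, 6] and its complement. *)
Definition looks_halted (p : nat) : bool :=
  let n := pfst p in let m := psnd p in let E := 2 ^ (n + 4) in
  let d := (psnd (psnd m)).+1 in
  ~~ ((pfst (psnd m) * E + 2 * d <= pfst m * E) &&
      (pfst m * E <= pfst (psnd m) * E + 6 * d)).

Lemma crec_looks_halted : crec looks_halted.
Proof. by rewrite /looks_halted; crec. Qed.

(** Lets the sets indexed by programs be reindexed by numbers, for the countable union in
    [cond_noncomputable]. *)
Lemma code_num_inj : injective code_num.
Proof.
have pI p q : Cantor.to_nat p = Cantor.to_nat q -> p = q.
  by move=> /(congr1 Cantor.of_nat); rewrite !pairK.
elim=> [||||| f IHf g IHg | f IHf g IHg | f IHf g IHg | f IHf]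
  [||||| f' g' | f' g' | f' g' | f'] //= /pI[] //;
  [move=> /pI[/IHf -> /IHg ->]|move=> /pI[/IHf -> /IHg ->]
  |move=> /pI[/IHf -> /IHg ->]|move=> /IHf ->] => //.
Qed.

Lemma prefix_num_ext b b' t : (forall i, i < t -> b i = b' i) ->
  prefix_num b t = prefix_num b' t.
Proof.
elim: t b b' => //= t IH b b' H; rewrite H//; congr (_ + _.*2).
by apply: IH => i it; exact: H.
Qed.

Lemma prefix_num_bits t i : i < 2 ^ t -> prefix_num (fun j => odd (iter j half i)) t = i.
Proof.
elim: t i => [|t IH] i; first by rewrite expn0; case: i.
rewrite expnS => it; rewrite -[RHS]odd_double_half /=; congr (_ + _.*2).
rewrite -[RHS]IH; last by lia.
by apply: prefix_num_ext => j _ /=; rewrite -iterS iterSr.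
Qed.

Lemma prefix_num_cylinder t i : i < 2 ^ t ->
  [set b : cantor | prefix_num b t = i] =
  cylinder (mkseq (fun j => odd (iter j half i)) t).
Proof.
move=> it; apply/seteqP; split => b /= => [<-|/cylinderP H].
  by apply/cylinderP => j jt; rewrite bits_prefix_num.
by rewrite (prefix_num_ext H) prefix_num_bits.
Qed.

End halting.

Lemma measurable_prefix_num (p : pred nat) t :
  measurable [set b : cantor | p (prefix_num b t)].
Proof.
rewrite (_ : mkset _ = [set b : cantor | exists i, p i /\ prefix_num b t = i]).
  apply: measurable_exists => i; apply: measurable_conj; first exact: measurable_cst_prop.
  have [it|it] := ltnP i (2 ^ t).
    by rewrite prefix_num_cylinder//; exact: measurable_cylinder.
  rewrite (_ : mkset _ = set0)//; apply/seteqP; split => b //= E.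
  by move: it; rewrite -E leqNgt prefix_num_lt.
by apply/seteqP; split => b /= => [pb|[i [pi ->]]//]; exists (prefix_num b t).
Qed.

(** Induction on the program: a query reads one bit, and the other clauses combine measurable
    conditions through countable quantifiers. *)
Lemma measurable_code_eval c a y : measurable [set b : cantor | code_eval b c a y].
Proof.
elim: c a y => [||||| f IHf g IHg | f IHf g IHg | f IHf g IHg | f IHf] a y /=;
  try exact: measurable_cst_prop.
- rewrite (_ : mkset _ = [set b : cantor | exists c : bool, b a = c /\ y = c]).
    apply: measurable_exists => c; apply: measurable_conj.
      exact: measurable_coord_eq.
    exact: measurable_cst_prop.
  by apply/seteqP; split => b /= => [->|[c [-> ->]]//]; exists (b a).
- apply: measurable_exists => u; apply: measurable_exists => v.
  rewrite (_ : mkset _ = [set b : cantor | code_eval b f a u /\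
      (code_eval b g a v /\ y = Cantor.to_nat (u, v))]).
    apply: measurable_conj => //; apply: measurable_conj => //.
    exact: measurable_cst_prop.
  by apply/seteqP; split => b /= => [[]|[? []]].
- rewrite (_ : mkset _ = [set b : cantor |
      exists u, code_eval b g a u /\ code_eval b f u y]).
    by apply: measurable_exists => u; exact: measurable_conj.
  by apply/seteqP; split => b /= [u]; [exists u|case; exists u].
- move: (Cantor.of_nat a).1 (Cantor.of_nat a).2 => {}a n.
  elim: n y => [|n IHn] y /=; first exact: IHf.
  rewrite (_ : mkset _ = [set b : cantor | exists u,
    primrec_rel (code_eval b f) (code_eval b g) a n u /\
    code_eval b g (Cantor.to_nat (a, Cantor.to_nat (n, u))) y]).
    by apply: measurable_exists => u; exact: measurable_conj.
  by apply/seteqP; split => b /= [u]; [exists u|case; exists u].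
- apply: measurable_conj => //; apply: measurable_forall => i.
  by apply: measurable_imply; apply: measurable_exists => z.
Qed.

(** * A program decides halting only for a null set of oracles *)

Section nullity.
Context (R : realType) (lam : probability cantor R).
Hypothesis lamE : forall x, lam (cylinder x) = (2 ^- size x)%:E.

(** The 2^t prefixes give disjoint cylinders of measure 2^-t each, so measures become the counts
    that [threshold] computes. *)
Lemma lam_prefix_num (p : pred nat) t : lam [set b : cantor | p (prefix_num b t)] =
  ((\sum_(i < 2 ^ t) p i)%:R * 2 ^- t)%:E.
Proof.
rewrite (_ : mkset _ =
  \big[setU/set0]_(i < 2 ^ t | p i) [set b : cantor | prefix_num b t = i]).
  have mF (i : 'I_(2 ^ t)) : measurable [set b : cantor | prefix_num b t = i].
    by rewrite prefix_num_cylinder//; exact: measurable_cylinder.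
  apply: (etrans (measure_bigsetU_ord_cond lam (fun i _ => mF i) _)).
    by move=> i j _ _ [b /= [-> ?]]; exact/val_inj.
  rewrite (eq_bigr (fun=> (2 ^- t : R)%:E)); last first.
    move=> i _; rewrite prefix_num_cylinder//.
    by apply: (etrans (lamE _)); rewrite size_mkseq.
  rewrite sumEFin; congr EFin; rewrite natr_sum mulr_suml [LHS]big_mkcond /=.
  by apply: eq_bigr => i _; case: (p i); rewrite ?mul1r ?mul0r.
apply/seteqP; split => b /=.
  move=> pb; rewrite -bigcup_seq_cond; exists (Ordinal (prefix_num_lt b t)) => //=.
  by rewrite mem_index_enum.
by rewrite -bigcup_seq_cond => -[i /= /andP[_ pi] ->].
Qed.

(** Phrased with the machine, since its runs up to time [t] are what [threshold] counts. *)
Definition outputs (c : Defs.code) (a s : nat) : set cantor :=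
  \bigcup_t [set b | run (code_num c) a t (prefix_num b t) = Cantor.to_nat (s, 0%N)].

Lemma measurable_run e a s t :
  measurable [set b : cantor | run e a t (prefix_num b t) = s].
Proof.
rewrite (_ : mkset _ = [set b : cantor | run e a t (prefix_num b t) == s]).
  exact: (measurable_prefix_num (fun i => run e a t i == s)).
by apply/seteqP; split => b /= /eqP.
Qed.

Lemma measurable_outputs c a s : measurable (outputs c a s).
Proof. by apply: bigcup_measurable => t _; exact: measurable_run. Qed.

Lemma lam_run e a s t :
  lam [set b : cantor | run e a t (prefix_num b t) = s] =
  ((\sum_(i < 2 ^ t) (run e a t i == s))%:R * 2 ^- t)%:E.
Proof.
rewrite -(lam_prefix_num (fun i => run e a t i == s)); congr (lam _).
by apply/seteqP; split => b /= /eqP.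
Qed.

(** A program receives its own number as part of the input, which provides the self-reference of the
    diagonal argument. *)
Local Notation question c J := (Cantor.to_nat (code_num c, J)).
Local Notation fact c J s := (Cantor.to_nat (question c J, s)).

Lemma thresholdE c J s t : threshold (fact c J s) t <-> (1%:E <
  J%:R%:E * lam [set b : cantor |
    run (code_num c) (question c J) t (prefix_num b t) = Cantor.to_nat (s, 0%N)])%E.
Proof.
rewrite lam_run -EFinM lte_fin mulrA ltr_pdivlMr ?exprn_gt0// mul1r.
by rewrite -natrX -natrM ltr_nat /threshold pairK /= pairK.
Qed.

Lemma halting_time_Some c J s : halting_time (fact c J s) ->
  (1%:E < J%:R%:E * lam (outputs c (question c J) s))%E.
Proof.
rewrite /halting_time; case: pselect => // -[t /thresholdE ht] _.
apply: lt_le_trans ht _; apply: lee_pmul => //.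
apply: le_measure; rewrite ?inE.
- exact: measurable_run.
- exact: measurable_outputs.
- by move=> b bt; exists t.
Qed.

(** By [run_mono] the event is the increasing union of its time slices; each slice obeys the bound,
    and the bound passes to the limit. *)
Lemma halting_time_None c J s : halting_time (fact c J s) = None ->
  (J%:R%:E * lam (outputs c (question c J) s) <= 1%:E)%E.
Proof.
rewrite /halting_time; case: pselect => // ne _.
pose F t := [set b : cantor |
  run (code_num c) (question c J) t (prefix_num b t) = Cantor.to_nat (s, 0%N)].
have cF : lam (F t) @[t --> \oo] --> lam (outputs c (question c J) s).
  apply: (nondecreasing_cvg_mu (mu := lam)) => //.
  - by move=> t; exact: measurable_run.
  - exact: measurable_outputs.
  - by move=> t t' tt'; apply/subsetPset => b; exact: run_mono.
have cJ : (J%:R%:E * lam (F t))%E @[t --> \oo] -->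
    (J%:R%:E * lam (outputs c (question c J) s))%E.
  exact: cvgeZl.
rewrite -(cvg_lim _ cJ)//; apply: lime_le; first by apply/cvg_ex; eexists; exact: cJ.
apply: nearW => t; rewrite leNgt; apply/negP => /thresholdE ht.
by apply: ne; exists t.
Qed.

Lemma exists_not_halting c J : (0 < J)%N ->
  exists s, halting_time (fact c J s) == None.
Proof.
move=> J0; apply: contrapT => Hall.
have H s : (1%:E < J%:R%:E * lam (outputs c (question c J) s))%E.
  apply: halting_time_Some; case E : (halting_time _) => //.
  by case: Hall; exists s; rewrite E.
(* Disjoint because the machine is deterministic: one oracle gives at most one output. *)
have triv : trivIset setT (fun s : 'I_J => outputs c (question c J) s).
  move=> i j _ _ [b [[t _ ti] [t' _ tj]]]; apply/val_inj.
  exact: run_inj ti tj.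
have mO (i : 'I_J) : measurable (outputs c (question c J) i) by exact: measurable_outputs.
have S1 : (\sum_(i < J) lam (outputs c (question c J) i) <= 1%:E)%E.
  rewrite -(measure_bigsetU_ord lam xpredT mO triv).
  by apply: probability_le1; apply: bigsetU_measurable => i _; exact: mO.
have finO s : lam (outputs c (question c J) s) =
    (fine (lam (outputs c (question c J) s)))%:E.
  by rewrite fineK// fin_num_measure//; exact: measurable_outputs.
have Jr : (0 : R) < J%:R by rewrite ltr0n.
have H' s : J%:R^-1 < fine (lam (outputs c (question c J) s)).
  have := H s; rewrite finO -EFinM lte_fin mulrC.
  by rewrite -ltr_pdivrMr// div1r.
have : \sum_(i < J) fine (lam (outputs c (question c J) i)) <= 1.
  by rewrite -lee_fin -sumEFin (eq_bigr _ (fun (i : 'I_J) _ => esym (finO i))).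
rewrite leNgt => /negP; apply.
have -> : (1 : R) = \sum_(i < J) J%:R^-1.
  by rewrite sumr_const card_ord -[RHS]mulr_natl mulfV// gt_eqF.
(* A sum of strict inequalities is strict only if it has a term: this is where J > 0 enters. *)
by apply: ltr_sum => //; apply/hasP; exists (Ordinal J0).
Qed.

Lemma deciders_null c (A : set cantor) : measurable A ->
  (forall b n, A b -> code_eval b c n (halting_time n : bool)) -> lam A = 0%E.
Proof.
move=> mA Ac.
have bnd J : (0 < J)%N -> (J%:R%:E * lam A <= 1%:E)%E.
  (* [Mu c] is the searching program: on input [question (Mu c) J] it looks for the least [s] for
     which [c] answers 0, that is, claims that [fact (Mu c) J s] does not halt. *)
  move=> J0; have ex := exists_not_halting (Mu c) J0.
  case: (ex_minnP ex) => s /eqP hs smin.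
  apply: le_trans (halting_time_None hs); apply: lee_pmul => //.
  apply: le_measure; rewrite ?inE//; first exact: measurable_outputs.
  move=> b Ab; have [|t ht] := @run_complete b (Mu c) (question (Mu c) J) s.
    split; first by have := Ac b (fact (Mu c) J s) Ab; rewrite hs.
    move=> i si; exists 0%N; have := Ac b (fact (Mu c) J i) Ab.
    case E : (halting_time _) => //; have := smin i; rewrite E => /(_ isT).
    by rewrite leqNgt si.
  by exists t.
have finA : lam A = (fine (lam A))%:E by rewrite fineK// fin_num_measure.
apply/eqP; rewrite eq_le measure_ge0 andbT; apply/lee_addgt0Pr => e e0.
rewrite add0e; have [k _ /(_ k (leqnn k)) /ltW ke] := near_infty_natSinv_lt (PosNum e0).
rewrite finA lee_fin; apply: le_trans ke.
have := bnd k.+1 isT; rewrite finA -EFinM lee_fin mulrC -ler_pdivlMr ?ltr0n//.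
by rewrite div1r.
Qed.

End nullity.

Lemma rat_of_codeE p q d :
  rat_of_code (Cantor.to_nat (p, Cantor.to_nat (q, d))) = (p%:R - q%:R) / d.+1%:R.
Proof. by rewrite /rat_of_code pairK pairK. Qed.

(** * Computability of the joint law and noncomputability of its conditionals *)

Section conclusion.
Context (R : realType) (lam : probability cantor R) (Q : probability nat R).
Hypothesis lamE : forall x, lam (cylinder x) = (2 ^- size x)%:E.
Hypothesis QE : forall n (c : bool), Q [set (c + n.*2)%N] = (2 ^- n.+2)%:E.
Context (P : probability (nat * cantor)%type R).
Hypothesis PE : forall A,
  P A = (Q \x lam)%E ((fun mb => (reveal halting_time mb.1 mb.2, mb.2)) @^-1` A).

(** The values are dyadic rationals and are output exactly, whatever the precision [k]. The
    denominator is named by its predecessor, as [rat_of_code] adds 1. *)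
Lemma computable_joint : computable_measure P.
Proof.
pose f p := let v := pfst (pfst p) in let s := psnd (pfst p) in
  Cantor.to_nat (weight_num v s,
    Cantor.to_nat (0, (2 ^ (v./2.+2 + str_size s)).-1))%N.
have [c oc Hc] : crec f.
  rewrite /f; have Hw : crec (fun p => weight_num (pfst (pfst p)) (psnd (pfst p))).
    by apply: crec_weight_num; crec.
  have Hs : crec (fun p => str_size (psnd (pfst p))).
    by apply: crec_str_size; crec.
  by crec.
exists c => // b [v x] k /=; eexists; first exact: Hc.
rewrite /f !pairK /= ?pairK /= rat_of_codeE subr0 prednK ?expn_gt0// str_sizeE.
have := joint_cylinder lamE QE PE v./2 (odd v) x.
rewrite odd_double_half weight_numE => -> /=.
rewrite fmorph_div /= !ratr_nat natrX subrr normr0.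
by rewrite invr_ge0 exprn_ge0.
Qed.

Lemma looks_haltedP b n m :
  `| ratr (rat_of_code m) - limit_cond Q halting_time [set n.*2] b | <= 2 ^- (n + 4) ->
  looks_halted (Cantor.to_nat (n, m)) = halting_time n :> bool.
Proof.
rewrite -[n.*2]/(false + n.*2)%N (limit_cond_set1 QE) /looks_halted pairK /=.
have -> : m = Cantor.to_nat (pfst m, Cantor.to_nat (pfst (psnd m), psnd (psnd m))).
  by do 2![rewrite -surjective_pairing Cantor.cancel_to_of].
move: (pfst m) (pfst (psnd m)) (psnd (psnd m)) => p q d; rewrite ?pairK /= ?pairK /=.
rewrite rat_of_codeE fmorph_div rmorphB /= !ratr_nat.
set E := (2 ^ (n + 4))%N; set D := d.+1.
have D0 : (0 : R) < D%:R by rewrite ltr0n.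
have E0 : (0 : R) < E%:R by rewrite ltr0n expn_gt0.
have EE : 2 ^- (n + 4) = E%:R^-1 :> R by rewrite natrX.
have E4 : 2 ^- n.+2 = 4 / E%:R :> R.
  rewrite natrX !exprD !exprS expr0; field.
  by rewrite expf_neq0.
clearbody E D; rewrite EE E4; set w := (X in X%:R * _).
move=> H.
(* Multiply by [E * D]. As [w] is 0, 1 or 2, the target is 0, 4 or 8 times [D], and an error of at
   most [D] cannot cross 2 or 6 times [D]. *)
have {}H : `|(p%:R - q%:R) * E%:R - 4 * w%:R * D%:R| <= D%:R :> R.
  have -> : (p%:R - q%:R) * E%:R - 4 * w%:R * D%:R =
     ((p%:R - q%:R) / D%:R - w%:R * (4 / E%:R)) * (E%:R * D%:R) :> R.
    by field; rewrite !gt_eqF.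
  rewrite normrM [X in _ * X]gtr0_norm ?mulr_gt0//.
  rewrite -ler_pdivlMr ?mulr_gt0// (_ : D%:R / (E%:R * D%:R) = E%:R^-1)//.
  by field; rewrite !gt_eqF.
move: H; rewrite ler_norml => /andP[H1 H2].
have L x y : (x <= y)%N = (x%:R <= y%:R :> R) by rewrite ler_nat.
rewrite !L !(natrM, natrD).
move: D0 H1 H2; move: (D%:R : R) (E%:R : R) (p%:R : R) (q%:R : R) => D' E' p' q' D0.
rewrite /w; case: (halting_time n) => [s|] /= H1 H2.
  apply/negP => /andP[H3 H4]; move: H1 H2; rewrite -muln2 natrM.
  by case: (b s) => /=; rewrite ?mulr0n ?mulr1n => H1 H2; lra.
by apply/negbTE; rewrite negbK; apply/andP; split; lra.
Qed.

(** Asking [c] for the probability of 2n up to 2^-(n+4) and applying [looks_halted] decides halting,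
    so [deciders_null] applies; it also requires the measurability proved first. *)
Lemma cond_approx_null c :
  lam [set b | approximates b c (fun n : nat => n) (fun n => cond P [set n] b)] = 0%E /\
  measurable [set b : cantor |
    approximates b c (fun n : nat => n) (fun n => cond P [set n] b)].
Proof.
have mA : measurable [set b : cantor |
    approximates b c (fun n : nat => n) (fun n => cond P [set n] b)].
  apply: measurable_forall => n; apply: measurable_forall => k.
  rewrite (_ : mkset _ = [set b : cantor | exists m,
    code_eval b c (Cantor.to_nat (n, k)) m /\
    `|ratr (rat_of_code m) - cond P [set n] b| <= 2 ^- k]); last first.
    by apply/seteqP; split => b /= [m]; [exists m|case; exists m].
  apply: measurable_exists => m; apply: measurable_conj.
    exact: measurable_code_eval.
  rewrite (_ : mkset _ = [set b : cantor |
    `|ratr (rat_of_code m) - limit_cond Q halting_time [set n] b| <= 2 ^- k]); last first.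
    by apply/seteqP; split => b /=; rewrite (condE lamE PE).
  rewrite -(odd_double_half n).
  case hn : (halting_time n./2) => [s|].
    (* The conditional probability depends on [b] only through [b s], so the two values [v] of this
       bit are treated separately. *)
    rewrite (_ : mkset _ = [set b : cantor | exists v, b s = v /\
      `|ratr (rat_of_code m) - (v == odd n).*2%:R * 2 ^- n./2.+2| <= 2 ^- k :> R]).
      apply: measurable_exists => v; apply: measurable_conj.
        exact: measurable_coord_eq.
      exact: measurable_cst_prop.
    apply/seteqP; split => b /=; rewrite (limit_cond_set1 QE) hn.
      by move=> H; exists (b s).
    by move=> [v [<-]].
  rewrite (_ : mkset _ = [set b : cantor |
      `|ratr (rat_of_code m) - 1%:R * 2 ^- n./2.+2| <= 2 ^- k :> R]).
    exact: measurable_cst_prop.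
  by apply/seteqP; split => b /=; rewrite (limit_cond_set1 QE) hn.
split=> //.
have [ct _ Hct] := crec_looks_halted; have [ci _ Hci] := crec_id.
have [ca _ Hca] : crec (fun n => Cantor.to_nat (n + n, n + 4))%N by crec.
apply: (deciders_null lamE (c := Comp ct (Pair ci (Comp c ca)))) => // b n Ab.
have [m Hm] := Ab n.*2 (n + 4)%N; rewrite (condE lamE PE) => /looks_haltedP <-.
exists (Cantor.to_nat (n, m)); last exact: Hct.
exists n, m; split=> //; exists (Cantor.to_nat (n.*2, n + 4))%N => //.
by rewrite -addnn.
Qed.

Lemma cond_noncomputable :
  measurable [set b : cantor | ~ cond_computable_rel P b] /\
  marginal P [set b : cantor | ~ cond_computable_rel P b] = 1%E.
Proof.
pose A c := [set b : cantor |
  approximates b c (fun n : nat => n) (fun n => cond P [set n] b)].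
(* The sets [A c] indexed by numbers; [B e] is empty if [e] is not the number of a program. *)
pose B e := [set b | exists c, code_num c = e /\ A c b].
have BE e : B e = set0 \/ exists c, B e = A c.
  have [[c ce]|ne] := pselect (exists c, code_num c = e); [right; exists c|left].
    apply/seteqP; split => b /= => [[c' [ce']]|Ac]; last by exists c.
    by rewrite (code_num_inj (etrans ce (esym ce'))).
  by apply/seteqP; split => b //= [c [ce _]]; apply: ne; exists c.
have mB e : measurable (B e).
  by have [->|[c ->]] := BE e; [exact: measurable0|have [] := cond_approx_null c].
have B0 e : lam (B e) = 0%E.
  by have [->|[c ->]] := BE e; [exact: measure0|have [] := cond_approx_null c].
have mU : measurable (\bigcup_e B e) by exact: bigcup_measurable.
have -> : [set b : cantor | ~ cond_computable_rel P b] = ~` \bigcup_e B e.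
  congr (~` _); apply/seteqP; split => b /= => [[c Ac]|[e _ [c [_ Ac]]]].
    by exists (code_num c) => //; exists c.
  by exists c.
split; first exact: measurableC.
rewrite /marginal (joint_setT PE); last exact: measurableC.
rewrite probability_setC// (_ : lam _ = 0%E) ?sube0//.
apply/(negligibleP lam mU)/negligible_bigcup => e.
by apply/(negligibleP lam (mB e)); exact: B0.
Qed.

End conclusion.

Theorem theorem7 (R : realType) :
  exists P : probability (nat * cantor)%type R,
    [/\ computable_measure P,
        (forall S : set nat,
           (forall b : cantor, cond_defined P S b) /\
           continuous (cond P S : cantor_space -> R))
      & measurable [set b : cantor | ~ cond_computable_rel P b] /\
        marginal P [set b : cantor | ~ cond_computable_rel P b] = 1%E].
Proof.
have [lam lamE] := fair_coin_exists R.
have [Q QE] := weights_exist lamE.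
have [P PE] := joint_exists lam Q halting_time.
exists P; split.
- exact: (computable_joint lamE QE PE).
- move=> S; split; first exact: (cond_definedP lamE PE).
  exact: (continuous_cond lamE PE).
- exact: (cond_noncomputable lamE QE PE).
Qed.
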